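(* Let $k$ be odd. A matching of size $k$ is an isolated vertex of $\mathbf{DCM}_k$ if and only if it is an I-matching.
   Context: Let $k\ge 1$ and let $X_{2k}=\{P_1,\dots,P_{2k}\}$ be $2k$ points in convex position in the plane, labeled in clockwise cyclic order; indices are taken modulo $2k$. A matching of $X_{2k}$ means a set of $k$ pairwise non-crossing straight segments (edges) with endpoints in $X_{2k}$ covering every point exactly once; its size is $k$. Two matchings $M,M'$ of $X_{2k}$ are disjoint compatible if they have no common edge and no edge of $M$ crosses an edge of $M'$. $\mathbf{DCM}_k$ is the graph whose vertices are the matchings of $X_{2k}$, two being adjacent iff they are disjoint compatible. A block of a matching $M$ is a pair of edges $\{P_iP_{i+3},P_{i+1}P_{i+2}\}\subseteq M$. If $K$ is a block of a matching $N$ of size $k+2$, then $N-K$ denotes the set $N\setminus K$, regarded as a matching of the remaining $2k$ points (which are in convex position) with their inherited cyclic order, i.e. as a matching of size $k$ defined up to cyclic relabeling. I-matchings are defined recursively: the unique matching of size $1$ is an I-matching; for odd $k\ge 3$, a matching $N$ of size $k$ is an I-matching iff it has a block $K$ such that $N-K$ is an I-matching (this notion is invariant under cyclic relabeling). *)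

(* Defs.v *)
From mathcomp Require Import all_boot.
Set Implicit Arguments. Unset Strict Implicit. Unset Printing Implicit Defensive.

(* Points P_1..P_n in convex position, clockwise, are modelled by 'I_n
   (P_{j+1} <-> j); only the cyclic order matters for crossings.
   An edge (segment) is a 2-element set of points. *)

Definition ord_cross n (e f : {set 'I_n}) : Prop :=
  exists a b c d : 'I_n,
    e = [set a; b] /\ f = [set c; d] /\ a < c /\ c < b /\ b < d.

(* two chords of a convex polygon cross (at an interior point) iff their
   endpoints alternate along the boundary *)
Definition cross n (e f : {set 'I_n}) : Prop := ord_cross e f \/ ord_cross f e.

Definition is_matching n (M : {set {set 'I_n}}) : Prop :=
  (forall e, e \in M -> #|e| = 2) /\
  (forall x : 'I_n, #|[set e in M | x \in e]| = 1) /\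
  (forall e f, e \in M -> f \in M -> ~ cross e f).

Definition disj_compat n (M M' : {set {set 'I_n}}) : Prop :=
  [disjoint M & M'] /\
  (forall e f, e \in M -> f \in M' -> ~ cross e f).

Definition isolated n (M : {set {set 'I_n}}) : Prop :=
  forall M', is_matching M' -> ~ disj_compat M M'.

Definition modpt (n : nat) (j : nat) : 'I_n.+1 := Ordinal (ltn_pmod j (ltn0Sn n)).

Definition block n (i : 'I_n.+4) : {set {set 'I_n.+4}} :=
  [set [set i; modpt n.+3 (i + 3)]; [set modpt n.+3 (i + 1); modpt n.+3 (i + 2)]].

(* cyclic relabeling after removing points i..i+3: point p gets the label
   (p - (i+4)) mod (n+4), which lies in [0,n) for the remaining points *)
Definition relabel n (i p : 'I_n.+4) : nat :=
  (p + (n.+4).*2 - (i + 4)) %% n.+4.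

Definition remove_block n (N : {set {set 'I_n.+4}}) (i : 'I_n.+4)
  : {set {set 'I_n}} :=
  [set [set q : 'I_n | [exists (p : 'I_n.+4 | p \in e), relabel i p == q]] | e : {set 'I_n.+4} in N :\: block i].

Inductive I_matching : forall n, {set {set 'I_n}} -> Prop :=
| I_base : I_matching [set [set (ord0 : 'I_2); ord_max]]
| I_step : forall n (N : {set {set 'I_n.+4}}) (i : 'I_n.+4),
    odd (n.+4)./2 ->
    is_matching N ->
    block i \subset N ->
    I_matching (remove_block N i) ->
    I_matching N.

(* Main.v *)
Require Import Defs.
From mathcomp Require Import all_boot.
From mathcomp Require Import zify.

Set Implicit Arguments. Unset Strict Implicit. Unset Printing Implicit Defensive.

(** A matching is encoded as the involution exchanging the two endpoints of each
edge.  Removing a block at positions i, ..., i+3 does not change whether a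
disjoint compatible matching exists: such a matching cannot cross P_iP_{i+3} nor
use P_{i+1}P_{i+2}, so it must contain P_iP_{i+1} and P_{i+2}P_{i+3}; conversely
these two edges can be added to any disjoint compatible matching of the rest.
Hence both implications reduce, by induction, to the fact that an isolated
matching of size at least 2 has a block, and even a block not straddling the
labels n-1, 0.  For a matching without such a block, a disjoint compatible
matching is built by recursion on the intervals enclosed by the edges. *)

(** * Matchings as involutions, and gluing of partial solutions *)

Definition between (a b x : nat) := (a < x < b) || (b < x < a).
Definition outside (a b x : nat) := ((x < a) && (x < b)) || ((a < x) && (b < x)).
(** The comparisons are strict, so chords sharing an endpoint never alternate and an edge may be
    compared with itself. The orientation of each chord is irrelevant. *)
Definition alternate (a b c d : nat) :=
  (between a b c && outside a b d) || (between a b d && outside a b c).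

(** Only values of [m] below [n] are constrained, so the same function can be kept when points are
    cut off at the end. *)
Definition mating (n : nat) (m : nat -> nat) : Prop :=
  (forall x, x < n -> [/\ m x < n, m (m x) = x & m x <> x]) /\
  (forall x y, x < n -> y < n -> ~~ alternate x (m x) y (m y)).

(* A matching of the points of [u, v) that is disjoint compatible with m; the
interval need not be stable under m. *)
Definition dc_on (n : nat) (m : nat -> nat) (u v : nat) : Prop :=
  exists f : nat -> nat,
  [/\ forall x, u <= x < v -> [/\ u <= f x < v, f (f x) = x, f x <> x & f x <> m x],
      forall x y, u <= x < v -> u <= y < v -> ~~ alternate x (f x) y (f y) &
      forall x y, u <= x < v -> y < n -> ~~ alternate x (f x) y (m y)].

Lemma dc_on_nil n m u : dc_on n m u u.
Proof. by exists id; split=> x; lia. Qed.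

Lemma dc_on_cat n m u v w :
  u <= v <= w -> dc_on n m u v -> dc_on n m v w -> dc_on n m u w.
Proof.
move=> uvw [f [f1 f2 f3]] [g [g1 g2 g3]].
exists (fun x => if x < v then f x else g x); split.
- move=> x xuw; case: (ltnP x v) => xv.
    have [|? ? ? ?] := f1 x; first by lia.
    by split=> //; do ?case: ifP; lia.
  have [|? ? ? ?] := g1 x; first by lia.
  by split=> //; do ?case: ifP; lia.
- move=> x y xuw yuw; case: (ltnP x v) => xv; case: (ltnP y v) => yv.
  + by apply: f2; lia.
  + have [|? _ _ _] := f1 x; first by lia.
    have [|? _ _ _] := g1 y; first by lia.
    by rewrite /alternate /between /outside; lia.
  + have [|? _ _ _] := g1 x; first by lia.
    have [|? _ _ _] := f1 y; first by lia.
    by rewrite /alternate /between /outside; lia.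
  + by apply: g2; lia.
- move=> x y xuw yn; case: (ltnP x v) => xv.
    by apply: f3; lia.
  by apply: g3; lia.
Qed.

(** The inner edges lie strictly between [u] and [v], so the new chord cannot cross them; it only
    has to be compared with [m]. *)
Lemma dc_on_wrap n m u v :
    u < v -> m u <> v -> m v <> u ->
    (forall y, y < n -> ~~ alternate u v y (m y)) ->
  dc_on n m u.+1 v -> dc_on n m u v.+1.
Proof.
move=> uv mu mv uvP [f [f1 f2 f3]].
exists (fun x => if x == u then v else if x == v then u else f x); split.
- move=> x xuv; case: (eqVneq x u) => xu; [|case: (eqVneq x v) => xv].
  + by subst x; split; do ?case: eqP; lia.
  + by subst x; split; do ?case: eqP; lia.
  + have [|? ? ? ?] := f1 x; first by lia.
    by split=> //; do ?case: eqP; lia.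
- move=> x y xuv yuv.
  case: (eqVneq x u) => xu; [|case: (eqVneq x v) => xv];
  (case: (eqVneq y u) => yu; [|case: (eqVneq y v) => yv]);
  try (by rewrite /alternate /between /outside; lia).
  + have [|? _ _ _] := f1 y; first by lia.
    by rewrite /alternate /between /outside; lia.
  + have [|? _ _ _] := f1 y; first by lia.
    by rewrite /alternate /between /outside; lia.
  + have [|? _ _ _] := f1 x; first by lia.
    by rewrite /alternate /between /outside; lia.
  + have [|? _ _ _] := f1 x; first by lia.
    by rewrite /alternate /between /outside; lia.
  + by apply: f2; lia.
- move=> x y xuv yn; case: (eqVneq x u) => xu; [|case: (eqVneq x v) => xv].
  + by rewrite xu; apply: uvP.
  + by rewrite xv; move: (uvP y yn); rewrite /alternate /between /outside; lia.
  + by apply: f3; lia.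
Qed.

Lemma dc_on_edge n m u :
  m u <> u.+1 -> m u.+1 <> u -> dc_on n m u u.+2.
Proof.
move=> mu mv; apply: dc_on_wrap => //; last exact: dc_on_nil.
by move=> y _; rewrite /alternate /between /outside; lia.
Qed.

(** * Stable intervals and matchings without blocks *)

Definition stable (m : nat -> nat) (a b : nat) :=
  forall x, a <= x < b -> a <= m x < b.

(** An edge leaving the interval would cross the edge at [a]. If [m a < a], the interval is
    empty. *)
Lemma stable_inside n m a : mating n m -> a < n -> stable m a.+1 (m a).
Proof.
move=> [m1 m2] an x xa.
have [? ma ?] := m1 a an.
have [|? mx ?] := m1 x; first by lia.
have := m2 a x an; rewrite /alternate /between /outside.
have : m x <> a by move=> E; move: mx; rewrite E; lia.
have : m x <> m a by move=> E; move: mx; rewrite E; lia.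
lia.
Qed.

(** The partner of the first point lies to its right. A later edge ending before [m a] would leave
    the inside of the first edge, against [stable_inside]. *)
Lemma stable_after n m a b :
  mating n m -> b <= n -> a < b -> stable m a b -> a < m a /\ stable m (m a).+1 b.
Proof.
move=> mm bn ab st; have [m1 _] := mm.
have [|? ma ?] := m1 a; first by lia.
have ? := st a.
split; first by lia.
move=> x xa; have [|? mx ?] := m1 x; first by lia.
have ? : m x <> a by move=> E; move: mx; rewrite E; lia.
have ? : m x <> m a by move=> E; move: mx; rewrite E; lia.
have := st x; have := @stable_inside n m a mm _ (m x).
lia.
Qed.

(* Blocks straddling the labels n-1, 0 are allowed. *)
Definition blockfree (n : nat) (m : nat -> nat) : Prop :=
  forall i, i.+3 < n -> m i = i.+3 -> m i.+1 = i.+2 -> False.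

(* The second claim leaves the last point b-1 free: if e_1, ..., e_r are the
outermost edges of [a, b), their insides are matched by the first claim (a leaf
below e_j would give a block), a-1 is joined to the left end of e_1 and the right
end of each e_j to the left end of e_{j+1}.  Joining b-1 to the next free point
closes this path. *)
Lemma dc_on_blockfree n m :
  mating n m -> blockfree n m -> forall a b, a <= b <= n -> stable m a b ->
  (dc_on n m a b \/ b = a.+2 /\ m a = a.+1) /\
  (forall x, a = x.+1 -> dc_on n m x b.-1).
Proof.
move=> mm bf a b; have [s le_s] := ubnP (b - a).
elim: s a b le_s => [|s IH] a b le_s abn st; first by lia.
case: (ltnP a b) => [ab|ba]; last first.
  have -> : b = a by lia.
  by split=> [|x ->]; [left|]; exact: dc_on_nil.
have [m1 _] := mm.
have [|acn ma mna] := m1 a; first by lia.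
have [|aca st2] := stable_after mm _ ab st; first by lia.
have ? := st a.
have st1 : stable m a.+1 (m a) by apply: stable_inside mm _; lia.
have [||inner path1] := IH _ _ _ _ st1; try by lia.
(* Taken at [x = m a]: this path starts at the right end of the first edge. *)
have [||_ /(_ _ erefl) path2] := IH _ _ _ _ st2; try by lia.
have {}inner : dc_on n m a.+1 (m a).
  case: inner => // -[E1 E2]; case: (bf a) => //; lia.
have tail : dc_on n m a.+1 b.-1 by apply: dc_on_cat inner path2; lia.
split; last first.
  (* By stability the left neighbour [x] of the interval is not matched to [x.+1], so these two may
     be joined. *)
  move=> x xa; subst a; have xst : ~ x.+1 <= m x < b.
    move=> H; have := st (m x); have [|] := m1 x; lia.
  have [|? mx ?] := m1 x; first by lia.
  apply: dc_on_cat (_ : dc_on n m x x.+2) _; first by lia.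
    by apply: dc_on_edge; lia.
  by [].
(* With several outermost edges, [a] and [b.-1] lie on different ones and may be joined around
   [tail]; stability keeps [m] from crossing this chord. *)
case: (ltnP (m a).+1 b) => cb.
  left; have -> : b = b.-1.+1 by lia.
  apply: dc_on_wrap tail; try by lia.
    by move=> E; have [|_] := m1 b.-1; rewrite ?E; lia.
  move=> y yn; have [? my ?] := m1 y yn.
  by have := st y; have := st (m y); rewrite /alternate /between /outside; lia.
have mab : m a = b.-1 by lia.
case: (eqVneq (m a) a.+1) => ma1; first by right; lia.
(* Under a single outermost edge, the path leaves [(m a).-1] free, to be joined to [m a]. *)
left; have path := path1 _ erefl.
apply: dc_on_cat path _; first by lia.
have -> : b = (m a).-1.+2 by lia.
have Ec : (m a).-1.+1 = m a by lia.
apply: dc_on_edge; rewrite Ec; last by lia.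
by move=> E; have [|_] := m1 (m a).-1; rewrite ?E ?ma; lia.
Qed.

Lemma blockfree_dc n m : mating n m -> 2 < n -> blockfree n m -> dc_on n m 0 n.
Proof.
move=> mm n2 bf; have st : stable m 0 n by move=> x xn; have [|] := mm.1 x; lia.
have [|] := dc_on_blockfree mm bf _ st; first by lia.
by case; [|lia].
Qed.

(** * Removing a block in the last four positions *)

Lemma mating_truncate n m :
    mating n.+4 m -> m n = n.+3 -> m n.+1 = n.+2 -> mating n m.
Proof.
move=> [m1 m2] mn mn1; split=> [x xn|x y xn yn]; last by apply: m2; lia.
have [|_ mn3 _] := m1 n; first by lia.
have [|_ mn2 _] := m1 n.+1; first by lia.
rewrite mn in mn3; rewrite mn1 in mn2.
have [|? mx ?] := m1 x; first by lia.
have : m x <> n by move=> E; rewrite E in mx; lia.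
have : m x <> n.+1 by move=> E; rewrite E in mx; lia.
have : m x <> n.+2 by move=> E; rewrite E in mx; lia.
have : m x <> n.+3 by move=> E; rewrite E in mx; lia.
by split=> //; lia.
Qed.

Lemma dc_on_truncate n m :
    mating n.+4 m -> m n = n.+3 -> m n.+1 = n.+2 ->
  dc_on n.+4 m 0 n.+4 <-> dc_on n m 0 n.
Proof.
move=> mm mn mn1; have [m1 m2] := mm.
have [mt _] := mating_truncate mm mn mn1.
have mlt x : x < n -> m x < n by move=> /mt[].
have [|_ mn3 _] := m1 n; first by lia.
have [|_ mn2 _] := m1 n.+1; first by lia.
rewrite mn in mn3; rewrite mn1 in mn2.
split=> [[f [f1 f2 f3]]|[f [f1 f2 f3]]].
  (* The edge from [n] to [n.+3] encloses [n.+1] and [n.+2], which [f] may not join to each other;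
     so [f] sends both to its ends. *)
  have fn1 : f n.+1 = n \/ f n.+1 = n.+3.
    have [|? _ ? ?] := f1 n.+1; first by lia.
    have := f3 n.+1 n; rewrite mn /alternate /between /outside; lia.
  have fn2 : f n.+2 = n \/ f n.+2 = n.+3.
    have [|? _ ? ?] := f1 n.+2; first by lia.
    have := f3 n.+2 n; rewrite mn /alternate /between /outside; lia.
  have [|_ ff1 _ _] := f1 n.+1; first by lia.
  have [|_ ff2 _ _] := f1 n.+2; first by lia.
  (* The opposite assignment would make these two edges of [f] cross. *)
  have {}fn1 : f n.+1 = n.
    case: fn1 => // E1; rewrite E1 in ff1.
    case: fn2 => E2; rewrite E2 in ff2; last by lia.
    have := f2 n.+1 n.+2; rewrite E1 E2 /alternate /between /outside; lia.
  rewrite fn1 in ff1.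
  have {}fn2 : f n.+2 = n.+3.
    by case: fn2 => // E2; rewrite E2 in ff2; lia.
  rewrite fn2 in ff2.
  exists f; split.
  + move=> x xn; have [|? fx ? ?] := f1 x; first by lia.
    have : f x <> n by move=> E; rewrite E in fx; lia.
    have : f x <> n.+1 by move=> E; rewrite E in fx; lia.
    have : f x <> n.+2 by move=> E; rewrite E in fx; lia.
    have : f x <> n.+3 by move=> E; rewrite E in fx; lia.
    by split=> //; lia.
  + by move=> x y ? ?; apply: f2; lia.
  + by move=> x y ? ?; apply: f3; lia.
apply: (@dc_on_cat _ _ _ n); first by lia.
  exists f; split=> // x y xn yn.
  case: (ltnP y n) => yn'; first exact: f3.
  have [|? _ _ _] := f1 x; first by lia.
  have [|? my _] := m1 y; first by lia.
  (* A point of the block has its partner in the block, beyond every edge of [f]. *)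
  have : n <= m y by case: ltnP => // /mlt; rewrite my; lia.
  by rewrite /alternate /between /outside; lia.
by apply: (@dc_on_cat _ _ _ n.+2); [lia|apply: dc_on_edge; lia..].
Qed.

(** * Invariance under rotation *)

Definition turn (t n x : nat) := if x + t < n then x + t else x + t - n.

Lemma turn_lt t n x : t <= n -> x < n -> turn t n x < n.
Proof. by rewrite /turn; case: ifP; lia. Qed.

(** Allowing [t = n] makes [n - t] an admissible turn for [t = 0] as well. *)
Lemma turnK t n x : t <= n -> x < n -> turn (n - t) n (turn t n x) = x.
Proof. by rewrite /turn; do !case: ifP; lia. Qed.

Lemma turnKV t n x : t <= n -> x < n -> turn t n (turn (n - t) n x) = x.
Proof. by rewrite /turn; do !case: ifP; lia. Qed.

(** A comparison flips exactly when one of the two points wraps around and the other does not. *)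
Lemma ltn_turn t n a b : t <= n -> a < n -> b < n ->
  (turn t n a < turn t n b) = (a < b) (+) (a + t < n) (+) (b + t < n).
Proof. by rewrite /turn; do 2 case: ifP; rewrite ?addbT ?addbF; lia. Qed.

Lemma alternate_turn t n a b c d :
    t <= n -> a < n -> b < n -> c < n -> d < n ->
  alternate (turn t n a) (turn t n b) (turn t n c) (turn t n d) = alternate a b c d.
Proof.
move=> *; rewrite /alternate /between /outside !ltn_turn //.
have [?|?] := ltnP (a + t) n; have [?|?] := ltnP (b + t) n;
have [?|?] := ltnP (c + t) n; have [?|?] := ltnP (d + t) n;
rewrite ?addbT ?addbF ?negbK; lia.
Qed.

(* The matching m after relabeling each point x as x + t mod n. *)
Definition turned (t n : nat) (m : nat -> nat) x := turn t n (m (turn (n - t) n x)).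

Lemma mating_turned t n m : t <= n -> mating n m -> mating n (turned t n m).
Proof.
move=> tn [m1 m2]; have tn' : n - t <= n by lia.
split=> [x xn|x y xn yn].
  have [lt_m mK mx] := m1 _ (turn_lt tn' xn); rewrite /turned; split.
  + exact: turn_lt.
  + by rewrite turnK // mK turnKV.
  + by move=> /(congr1 (turn (n - t) n)); rewrite turnK.
have xr := turn_lt tn' xn; have yr := turn_lt tn' yn.
rewrite -{1}(turnKV tn xn) -{1}(turnKV tn yn) alternate_turn //.
+ exact: m2.
+ by have [] := m1 _ xr.
+ by have [] := m1 _ yr.
Qed.

Lemma dc_on_turned t n m :
  t <= n -> mating n m -> dc_on n m 0 n -> dc_on n (turned t n m) 0 n.
Proof.
move=> tn [m1 m2] [f [f1 f2 f3]]; have tn' : n - t <= n by lia.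
have f1' x : x < n -> [/\ f x < n, f (f x) = x, f x <> x & f x <> m x].
  by move=> xn; have [|] := f1 x.
have [g1 g2] : mating n (turned t n f).
  apply: mating_turned => //; split=> [x /f1' []//|x y xn yn].
  exact: f2.
exists (turned t n f); split.
+ move=> x /= xn; have [] := g1 x xn; split=> //.
  have xr := turn_lt tn' xn; have [fr _ _ ne] := f1' _ xr.
  by move=> /(congr1 (turn (n - t) n)); rewrite !turnK //; have [] := m1 _ xr.
+ by move=> x y /= xn yn; exact: g2.
move=> x y /= xn yn; have xr := turn_lt tn' xn; have yr := turn_lt tn' yn.
rewrite -{1}(turnKV tn xn) -{1}(turnKV tn yn) alternate_turn //.
+ exact: f3.
+ by have [] := f1' _ xr.
+ by have [] := m1 _ yr.
Qed.

Lemma eq_dc_on n m m' u v :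
  v <= n -> (forall x, x < n -> m x = m' x) -> dc_on n m u v -> dc_on n m' u v.
Proof.
move=> vn e [f [f1 f2 f3]]; exists f; split=> // [x xv|x y xv yn].
  by rewrite -e; [exact: f1|lia].
by rewrite -e //; exact: f3.
Qed.

(** Turning by [n - t] undoes the turn on the points below [n], which are all that [dc_on] sees
    here. *)
Lemma dc_on_turnedE t n m :
  t <= n -> mating n m -> dc_on n (turned t n m) 0 n <-> dc_on n m 0 n.
Proof.
move=> tn mm; have tn' : n - t <= n by lia.
split; last exact: dc_on_turned.
move=> /(dc_on_turned tn' (mating_turned tn mm)); apply: eq_dc_on => // x xn.
have [m1 _] := mm; have [mn _ _] := m1 x xn.
by rewrite /turned (subKn tn) !turnK.
Qed.

(** * Translation between edge sets and involutions *)

Lemma set2_inj (T : finType) (a b c d : T) :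
  [set a; b] = [set c; d] -> (a = c /\ b = d) \/ (a = d /\ b = c).
Proof.
move=> /setP E; have := E a; have := E b; have := E c; have := E d.
rewrite !inE !eqxx ?orbT /= => /orP[]/eqP ? /orP[]/eqP ? /esym/orP[]/eqP ? /esym/orP[]/eqP ?.
all: intuition congruence.
Qed.

Lemma crossP n (a b c d : 'I_n) :
  cross [set a; b] [set c; d] <-> alternate a b c d.
Proof.
split.
  have H (u v x y u' v' x' y' : 'I_n) : [set u; v] = [set u'; v'] ->
      [set x; y] = [set x'; y'] -> u' < x' -> x' < v' -> v' < y' ->
      alternate u v x y /\ alternate x y u v.
    rewrite /alternate /between /outside.
    by move=> /set2_inj[][-> ->] /set2_inj[][-> ->]; lia.
  case=> -[a' [b' [c' [d' [e1 [e2 [? [? ?]]]]]]]].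
    by case: (H _ _ _ _ _ _ _ _ e1 e2).
  by case: (H _ _ _ _ _ _ _ _ e1 e2).
rewrite /alternate /between /outside => alt.
(* Eight cases: which chord owns the smallest endpoint, and the orientation of each chord. *)
have : (a < c < b) && (b < d) \/ (a < d < b) && (b < c) \/
       (b < c < a) && (a < d) \/ (b < d < a) && (a < c) \/
       (c < a < d) && (d < b) \/ (c < b < d) && (d < a) \/
       (d < a < c) && (c < b) \/ (d < b < c) && (c < a) by lia.
case=> [/andP[/andP[? ?] ?]|]; first by left; exists a, b, c, d.
case=> [/andP[/andP[? ?] ?]|]; first by left; exists a, b, d, c; rewrite (setUC [set d]).
case=> [/andP[/andP[? ?] ?]|]; first by left; exists b, a, c, d; rewrite (setUC [set b]).
case=> [/andP[/andP[? ?] ?]|].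
  by left; exists b, a, d, c; rewrite (setUC [set d]) (setUC [set b]).
case=> [/andP[/andP[? ?] ?]|]; first by right; exists c, d, a, b.
case=> [/andP[/andP[? ?] ?]|]; first by right; exists c, d, b, a; rewrite (setUC [set b]).
case=> [/andP[/andP[? ?] ?]|]; first by right; exists d, c, a, b; rewrite (setUC [set d]).
move=> /andP[/andP[? ?] ?].
by right; exists d, c, b, a; rewrite (setUC [set d]) (setUC [set b]).
Qed.

(** Since values from [n] on are free, one [m] may represent matchings of different sizes; this
    makes deleting a final block a mere change of [n]. *)
Definition represents n (M : {set {set 'I_n}}) (m : nat -> nat) : Prop :=
  mating n m /\
  forall e, e \in M <-> exists x y : 'I_n, e = [set x; y] /\ m x = y.

Lemma represents_edge n (M : {set {set 'I_n}}) m (x y : 'I_n) :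
  represents M m -> [set x; y] \in M <-> m x = y.
Proof.
move=> [[m1 _] mM]; split=> [/mM[x' [y' [/set2_inj[][-> ->] E]]] //|E].
  by have [] := m1 x' (ltn_ord x'); rewrite E.
by apply/mM; exists x, y.
Qed.

Lemma is_matching_represents n (M : {set {set 'I_n}}) :
  is_matching M -> exists m, represents M m.
Proof.
move=> [M1 [M2 M3]].
have ex (x : 'I_n) : exists y, [set x; y] \in M /\ x != y.
  have /eqP/cards1P[e He] := M2 x.
  have : e \in [set e in M | x \in e] by rewrite He set11.
  rewrite inE => /andP[eM xe].
  have /eqP/cards2P[a [b [ab E]]] := M1 e eM.
  move: xe eM; rewrite E !inE => /orP[]/eqP->; first by exists b.
  by rewrite setUC; exists a; rewrite eq_sym.
have uniq_mate (x y z : 'I_n) : [set x; y] \in M -> [set x; z] \in M -> y = z.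
  move=> yM zM; have /eqP/cards1P[e He] := M2 x.
  have : [set x; y] \in [set e in M | x \in e] by rewrite !inE eqxx yM.
  have : [set x; z] \in [set e in M | x \in e] by rewrite !inE eqxx zM.
  rewrite He !inE => /eqP <- /eqP /set2_inj; intuition congruence.
have {ex} [g gP] := fin_all_exists ex.
have gK x : g (g x) = x.
  by apply: (@uniq_mate (g x)); [|rewrite setUC]; have [] := gP x; have [] := gP (g x).
(* Beyond [n] the identity is a default value. *)
pose m x := if insub x is Some o then val (g o) else x.
have mE (x : 'I_n) : m x = g x by rewrite /m valK.
exists m; split; first split.
- move=> x xn; have -> : x = Ordinal xn by [].
  rewrite !mE gK; split=> // /val_inj E.
  by have [_] := gP (Ordinal xn); rewrite E eqxx.
- move=> x y xn yn; have -> : x = Ordinal xn by []; have -> : y = Ordinal yn by [].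
  rewrite !mE; apply/negP => /crossP; apply: M3.
    by have [] := gP (Ordinal xn).
  by have [] := gP (Ordinal yn).
move=> e; split=> [eM|[x [y [-> ]]]].
  have /eqP/cards2P[a [b [ab E]]] := M1 e eM.
  exists a, b; split=> //; rewrite mE; congr val.
  by apply: (@uniq_mate a); [have [] := gP a|rewrite -E].
by rewrite mE => /val_inj <-; have [] := gP x.
Qed.

Lemma represents_is_matching n (M : {set {set 'I_n}}) m :
  represents M m -> is_matching M.
Proof.
move=> rM; have [[m1 m2] mM] := rM; split; [|split].
- move=> e /mM[x [y [-> E]]]; rewrite cards2.
  case: eqP => // xy; have [_ _ []] := m1 x (ltn_ord x).
  by rewrite E xy.
- move=> x; have [mx mK _] := m1 x (ltn_ord x).
  rewrite (_ : [set _ in _ | _] = [set [set x; Ordinal mx]]) ?cards1 //.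
  apply/setP => e; rewrite !inE; apply/andP/eqP => [[/mM[a [b [-> E]]]]|->].
    rewrite !inE => /orP[]/eqP xE.
      have -> : Ordinal mx = b by apply: val_inj; rewrite /= xE.
      by rewrite xE.
    have -> : Ordinal mx = a.
      by apply: val_inj; rewrite /= xE -E; have [] := m1 a (ltn_ord a).
    by rewrite setUC xE.
  by rewrite !inE eqxx; split=> //; apply/(represents_edge _ _ rM).
- move=> e f /mM[a [b [-> E]]] /mM[c [d [-> F]]] /crossP.
  by rewrite -E -F; apply/negP; apply: m2.
Qed.

Definition matching_of n (m : nat -> nat) : {set {set 'I_n}} :=
  [set e | [exists x : 'I_n, exists y : 'I_n, (e == [set x; y]) && (m x == y)]].

Lemma represents_matching_of n m : mating n m -> represents (matching_of n m) m.
Proof.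
move=> mm; split=> // e; rewrite inE; split.
  by move=> /existsP[x /existsP[y /andP[/eqP-> /eqP E]]]; exists x, y.
by move=> [x [y [-> E]]]; apply/existsP; exists x; apply/existsP; exists y; rewrite E !eqxx.
Qed.

(** A function witnessing [dc_on] on all points is a neighbour of [M]: [f x <> m x] everywhere means
    that no edge is shared. *)
Lemma isolatedP n (M : {set {set 'I_n}}) m :
  represents M m -> isolated M <-> ~ dc_on n m 0 n.
Proof.
move=> rM; have [[m1 m2] mM] := rM; split.
  move=> iso [f [f1 f2 f3]].
  have mf : mating n f.
    by split=> [x xn|x y xn yn]; [have [|] := f1 x|exact: f2].
  have rf := represents_matching_of mf; have [_ fM] := rf.
  apply: (iso (matching_of n f)); first exact: represents_is_matching rf.
  split.
    rewrite -setI_eq0; apply/eqP/setP => e; rewrite !in_setI in_set0.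
    apply/negP => /andP[/mM[x [y [-> E]]]] /(represents_edge _ _ rf) F.
    by have [|_ _ _ []] := f1 x; rewrite ?E ?F ?ltn_ord.
  move=> e f' /mM[a [b [-> E]]] /fM[c [d [-> F]]] /crossP alt.
  have := f3 c a (ltn_ord c) (ltn_ord a); rewrite E F.
  by move: alt; rewrite /alternate /between /outside; lia.
move=> nodc M' M'm [dMM' cMM']; apply: nodc.
have [f rf] := is_matching_represents M'm; have [[f1 f2] fM] := rf.
exists f; split=> [x /= xn|x y /= xn yn|x y /= xn yn]; last 2 first.
- exact: f2.
- have [fn _ _] := f1 x xn; have [mn _ _] := m1 y yn.
  have fx : [set Ordinal xn; Ordinal fn] \in M' by apply/(represents_edge _ _ rf).
  have my : [set Ordinal yn; Ordinal mn] \in M by apply/(represents_edge _ _ rM).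
  have /crossP/= alt := cMM' _ _ my fx.
  by move: alt; rewrite /alternate /between /outside; lia.
have [fn fK fx] := f1 x xn; split=> // fm.
have fx' : [set Ordinal xn; Ordinal fn] \in M' by apply/(represents_edge _ _ rf).
have mx : [set Ordinal xn; Ordinal fn] \in M by apply/(represents_edge _ _ rM); rewrite /= fm.
by move: (disjointFr dMM' mx); rewrite fx'.
Qed.

(** * Block removal as rotation followed by truncation *)

Lemma modn_turn t n x : t <= n -> x < n -> (x + t) %% n = turn t n x.
Proof.
rewrite /turn => tn xn; case: ltnP => h; first by rewrite modn_small.
by rewrite -{1}(subnK h) modnDr modn_small //; lia.
Qed.

(** This is -(i+4) modulo n+4, the rotation carrying the block at [i] to the last four labels. *)
Definition block_shift n (i : nat) :=
  if i + 4 <= n.+4 then n.+4 - (i + 4) else (n.+4).*2 - (i + 4).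

Lemma block_shift_le n (i : 'I_n.+4) : block_shift n i <= n.+4.
Proof. by rewrite /block_shift; case: ifP; have := ltn_ord i; lia. Qed.

Lemma relabelE n (i p : 'I_n.+4) : relabel i p = turn (block_shift n i) n.+4 p.
Proof.
rewrite -modn_turn ?block_shift_le // /relabel /block_shift.
case: leqP => h; last by congr (_ %% _); have := ltn_ord i; lia.
rewrite -[in RHS]modnDr; congr (_ %% _); lia.
Qed.

Lemma turn_modpt n (i : 'I_n.+4) j :
  j < 4 -> turn (block_shift n i) n.+4 (modpt n.+3 (i + j)) = n + j.
Proof.
move=> j4 /=; rewrite modn_turn //; last lia.
by have := ltn_ord i; rewrite /turn /block_shift; do !case: ifP; lia.
Qed.

Lemma represents_remove_block n (N : {set {set 'I_n.+4}}) (i : 'I_n.+4) m :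
    represents N m -> block i \subset N ->
  let m' := turned (block_shift n i) n.+4 m in
  [/\ mating n.+4 m', m' n = n.+3, m' n.+1 = n.+2 &
      represents (remove_block N i) m'].
Proof.
move=> rN sub m'; have [mm mN] := rN; have [m1 _] := mm.
have tn := block_shift_le i.
have mm' : mating n.+4 m' by apply: mating_turned.
set r := turn (block_shift n i) n.+4.
set r' := turn (n.+4 - block_shift n i) n.+4.
have rK x : x < n.+4 -> r' (r x) = x by exact: turnK.
have r'K x : x < n.+4 -> r (r' x) = x by exact: turnKV.
have rlt x : x < n.+4 -> r x < n.+4 by exact: turn_lt.
have r'lt x : x < n.+4 -> r' x < n.+4 by apply: turn_lt; lia.
have m'r x : x < n.+4 -> m' (r x) = r (m x).
  by move=> xn; rewrite /m' /turned -/r' -/r rK.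
have i0 : modpt n.+3 (i + 0) = i by apply: val_inj; rewrite /= addn0 modn_small.
have rp j : j < 4 -> r (modpt n.+3 (i + j)) = n + j by exact: turn_modpt.
have b03 : [set i; modpt n.+3 (i + 3)] \in block i by rewrite !inE eqxx.
have b12 : [set modpt n.+3 (i + 1); modpt n.+3 (i + 2)] \in block i.
  by rewrite !inE eqxx orbT.
have /(represents_edge _ _ rN) m03 := subsetP sub _ b03.
have /(represents_edge _ _ rN) m12 := subsetP sub _ b12.
have rn : r i = n by rewrite -{1}i0 rp // addn0.
have rn1 : r (modpt n.+3 (i + 1)) = n.+1 by rewrite rp // addn1.
have m'n : m' n = n.+3 by rewrite -[in LHS]rn m'r // m03 rp // addn3.
have m'n1 : m' n.+1 = n.+2 by rewrite -[in LHS]rn1 m'r // m12 rp // addn2.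
have mt := mating_truncate mm' m'n m'n1.
split=> //; split=> // e.
have rimage (x y : 'I_n.+4) (x' y' : 'I_n) : r x = x' -> r y = y' ->
    [set q : 'I_n | [exists (p | p \in [set x; y]), relabel i p == q]] = [set x'; y'].
  move=> xx' yy'; apply/setP => q; rewrite !inE; apply/existsP/orP.
    move=> [p]; rewrite !inE => /andP[/orP[]/eqP-> /eqP]; rewrite relabelE -/r => E.
      by left; apply/eqP/val_inj; rewrite /= -E xx'.
    by right; apply/eqP/val_inj; rewrite /= -E yy'.
  move=> [/eqP->|/eqP->]; [exists x|exists y];
    by rewrite !inE relabelE -/r ?xx' ?yy' !eqxx ?orbT.
split.
  move=> /imsetP[e0]; rewrite inE => /andP[e0b /mN[x [y [E mxy]]] ->].
  rewrite {}E in e0b *.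
  have m'x : m' (r x) = r y by rewrite m'r ?mxy.
  have [_ m'K _] := mm'.1 _ (rlt x (ltn_ord x)).
  have [mt1 _] := mt.
  (* A label from [n] on would make the edge one of the two edges of the block. *)
  have xn : r x < n.
    case: ltnP => // rx; have := rlt x (ltn_ord x).
    have inv (z : 'I_n.+4) j : j < 4 -> r z = n + j -> z = modpt n.+3 (i + j).
      move=> j4 rz; apply: val_inj.
      by rewrite -[LHS](rK z) // rz -(rp j) // rK.
    have [|_ m'n3 _] := mm'.1 n; first by lia.
    have [|_ m'n2 _] := mm'.1 n.+1; first by lia.
    rewrite m'n in m'n3; rewrite m'n1 in m'n2.
    move=> rx'; have : [\/ r x = n, r x = n.+1, r x = n.+2 | r x = n.+3].
      have : r x = n \/ r x = n.+1 \/ r x = n.+2 \/ r x = n.+3 by lia.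
      by case=> [|[|[|]]]; [constructor 1|constructor 2|constructor 3|constructor 4].
    case=> E; rewrite E ?m'n ?m'n1 ?m'n2 ?m'n3 in m'x; move/esym in m'x;
      case/negP: e0b.
    - have -> : x = i by rewrite -i0; apply: inv; rewrite ?addn0.
      by have -> : y = modpt n.+3 (i + 3) by apply: inv; rewrite ?addn3.
    - have -> : x = modpt n.+3 (i + 1) by apply: inv; rewrite ?addn1.
      by have -> : y = modpt n.+3 (i + 2) by apply: inv; rewrite ?addn2.
    - rewrite setUC; have -> : x = modpt n.+3 (i + 2) by apply: inv; rewrite ?addn2.
      by have -> : y = modpt n.+3 (i + 1) by apply: inv; rewrite ?addn1.
    - rewrite setUC; have -> : x = modpt n.+3 (i + 3) by apply: inv; rewrite ?addn3.
      by have -> : y = i by rewrite -i0; apply: inv; rewrite ?addn0.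
  have [yn _ _] := mt1 _ xn; rewrite m'x in yn.
  exists (Ordinal xn), (Ordinal yn); split=> //.
  exact: rimage.
move=> [x [y [-> E]]].
have xN : x < n.+4 by apply: leq_trans (ltn_ord x) _; lia.
have yN : y < n.+4 by apply: leq_trans (ltn_ord y) _; lia.
pose p := Ordinal (r'lt _ xN); pose q := Ordinal (r'lt _ yN).
have rpx : r p = x by rewrite r'K.
have rqy : r q = y by rewrite r'K.
apply/imsetP; exists [set p; q]; last by rewrite (rimage p q x y).
rewrite inE; apply/andP; split.
  (* Points of the block have labels from [n] on, whereas [p] has label [x] below [n]. *)
  apply/negP; have nr j : j < 4 -> p <> modpt n.+3 (i + j).
    move=> j4 pE; move: rpx; rewrite pE rp // => nx.
    by have := ltn_ord x; rewrite -nx; lia.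
  have /= := (nr 0 isT, nr 1 isT, nr 2 isT, nr 3 isT); rewrite i0 => -[[[n0 n1] n2] n3].
  by rewrite !inE => /orP[]/eqP/set2_inj; tauto.
apply/(represents_edge _ _ rN).
rewrite -[LHS]rK; last by have [] := m1 p (ltn_ord p).
by rewrite -m'r // rpx E.
Qed.

(** * Isolated matchings and the two implications *)

Lemma isolated_remove_block n (N : {set {set 'I_n.+4}}) (i : 'I_n.+4) :
    is_matching N -> block i \subset N ->
  isolated N <-> isolated (remove_block N i).
Proof.
move=> /is_matching_represents[m rN] sub; have [mm _] := rN.
have [mm' m'n m'n1 rR] := represents_remove_block rN sub.
rewrite (isolatedP rN) (isolatedP rR) -(dc_on_turnedE (block_shift_le i) mm).
by rewrite dc_on_truncate.
Qed.

Lemma isolated_has_block n (N : {set {set 'I_n.+4}}) :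
  is_matching N -> isolated N -> exists i, block i \subset N.
Proof.
move=> /is_matching_represents[m rN] /(isolatedP rN) nodc; have [mm _] := rN.
case: (boolP [exists i, block i \subset N]) => [/existsP//|/existsPn nob].
case: nodc; apply: blockfree_dc => // i i3 mi mi1.
have iN : i < n.+4 by lia.
case/negP: (nob (Ordinal iN)); apply/subsetP => e; rewrite !inE.
by move=> /orP[]/eqP->; apply/(represents_edge _ _ rN); rewrite /= ?addn1 ?addn2 ?addn3 !modn_small; lia.
Qed.

Lemma represents_base :
  represents [set [set (ord0 : 'I_2); ord_max]] (fun x => 1 - x).
Proof.
split; first split; [by case=> [|[]]|by case=> [|[|[]]]; case=> [|[|[]]]|].
move=> e; rewrite inE; split=> [/eqP->|[x [y [-> E]]]]; first by exists ord0, ord_max.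
apply/eqP; have [x0|x1] := eqVneq x ord0.
  by rewrite x0; congr [set _; _]; apply: val_inj; rewrite /= -E x0.
have {}x1 : x = ord_max.
  by apply: val_inj; move: x1 (ltn_ord x); rewrite -val_eqE /=; lia.
by rewrite setUC x1; congr [set _; _]; apply: val_inj; rewrite /= -E x1.
Qed.

Lemma matching2 (M : {set {set 'I_2}}) :
  is_matching M -> M = [set [set ord0; ord_max]].
Proof.
move=> /is_matching_represents[m [[m1 _] mM]]; have [_ bM] := represents_base.
have mE x : x < 2 -> m x = 1 - x by move=> x2; have [] := m1 x x2; lia.
apply/setP => e; apply/idP/idP => [/mM|/bM] [x [y [eE E]]].
  by apply/bM; exists x, y; rewrite -mE.
by apply/mM; exists x, y; rewrite mE.
Qed.

(** The only possible partner of point 0 is the one it already has. *)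
Lemma isolated_base : isolated [set [set (ord0 : 'I_2); ord_max]].
Proof.
apply/(isolatedP represents_base) => -[f [f1 _ _]].
by have [|] := f1 0; lia.
Qed.

Lemma I_matching_isolated n (M : {set {set 'I_n}}) : I_matching M -> isolated M.
Proof.
move=> IM; elim: n M / IM => [|n N i _ mN bN _ iso]; first exact: isolated_base.
exact/(isolated_remove_block mN bN).
Qed.

(** The parity conditions say n = 2k with k odd, phrased on [n] so that induction can descend from
    [n.+4] to [n]. *)
Lemma isolated_I_matching n (M : {set {set 'I_n}}) :
  ~~ odd n -> odd n./2 -> is_matching M -> isolated M -> I_matching M.
Proof.
(* Parity excludes 0, 1 and 3 points, leaving the base case of 2 points and the step. *)
elim/ltn_ind: n M => -[|[|[|[|n]]]] // IH M.
  by move=> _ _ /matching2-> _; exact: I_base.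
rewrite /= !negbK => en on mM iM; have [i bM] := isolated_has_block mM iM.
have [m rM] := is_matching_represents mM.
apply: (I_step _ mM bM); first by rewrite /= !negbK.
apply: IH => //; try lia.
  by have [_ _ _ /represents_is_matching] := represents_remove_block rM bM.
exact/(isolated_remove_block mM bM).
Qed.

Theorem mainTheorem11 (k : nat) (M : {set {set 'I_(k.*2)}}) :
  odd k -> is_matching M -> (isolated M <-> I_matching M).
Proof.
move=> ok mM; split; last exact: I_matching_isolated.
by apply: isolated_I_matching mM; rewrite ?odd_double ?doubleK.
Qed.
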